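(* There is a universal constant $c>0$ with the following property. Let $n\in\mathbb{N}$ and $L\ge 1$ satisfy $5L\le \sqrt[4]{n}$. Then there are Banach spaces $(\mathbf{X},\|\cdot\|_{\mathbf{X}})$ and $(\mathbf{Y},\|\cdot\|_{\mathbf{Y}})$ with $\dim(\mathbf{X})=n$, and there is $\varepsilon>0$, such that for any $\varepsilon$-net $\mathcal{N}$ of the unit sphere $S_{\mathbf{X}}$ there is a $1$-Lipschitz mapping $f:\mathcal{N}\to\mathbf{Y}$ that satisfies $$\max_{a\in\mathcal{N}}\|F(a)-f(a)\|_{\mathbf{Y}}\ \ge\ c\,\frac{Ln}{e^{2\sqrt{(\log n)\log(4L)}}}\,\varepsilon$$ for every $L$-Lipschitz mapping $F:S_{\mathbf{X}}\to\mathbf{Y}$.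
   Context: Normed spaces are over $\mathbb{R}$. For a normed space $(\mathbf{X},\|\cdot\|_{\mathbf{X}})$, $S_{\mathbf{X}}=\{x\in\mathbf{X}:\|x\|_{\mathbf{X}}=1\}$, and subsets of $\mathbf{X}$ carry the metric induced by $\|\cdot\|_{\mathbf{X}}$. An $\varepsilon$-net of a metric space $(\mathcal{M},d)$ is a subset $\mathcal{N}\subseteq\mathcal{M}$ that is $\varepsilon$-separated ($d(a,b)\ge\varepsilon$ for all distinct $a,b\in\mathcal{N}$) and $\varepsilon$-dense ($\inf_{a\in\mathcal{N}}d(x,a)\le\varepsilon$ for every $x\in\mathcal{M}$). A mapping is $L$-Lipschitz if its Lipschitz constant is at most $L$. $\log$ is the natural logarithm. *)

(* Defs.v *)
From mathcomp Require Export all_boot all_order all_algebra.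
From mathcomp Require Export all_classical all_reals all_analysis.
Export numFieldNormedType.Exports.

Set Implicit Arguments.
Unset Strict Implicit.
Unset Printing Implicit Defensive.

Import Order.TTheory GRing.Theory Num.Theory.

Local Open Scope classical_set_scope.
Local Open Scope ring_scope.

(* The carriers below are normed modules without a [vectType] structure, so the
   dimension is expressed through the axiom of [vectType]: a linear bijection
   with the space of row vectors of length n. *)
Definition has_dim (R : realType) (n : nat) (X : normedModType R) : Prop :=
  inhabited (Vector.axiom n X).

Definition unit_sphere (R : realType) (X : normedModType R) : set X :=
  [set x | `|x| = 1].
Arguments unit_sphere {R} X.

(* [eps_net eps S N]: N is an eps-net of the metric space S, a subset of X with
   the metric of the norm. The infimum is taken in the extended reals because
   the real-valued [inf set0] is 0, which would make the empty set eps-dense. *)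
Definition eps_net (R : realType) (X : normedModType R) (eps : R)
    (S N : set X) : Prop :=
  [/\ N `<=` S,
      forall a b, N a -> N b -> a <> b -> eps <= `|a - b| &
      forall x, S x -> (ereal_inf [set `|x - a|%:E | a in N] <= eps%:E)%E].

Definition is_maximum (R : realType) (A : set R) (m : R) : Prop :=
  A m /\ ubound A m.

(* Main.v *)
From HB Require Import structures.
From mathcomp Require Import ring lra.
Require Import Defs.

Set Implicit Arguments.
Unset Strict Implicit.
Unset Printing Implicit Defensive.

Import Order.TTheory GRing.Theory Num.Theory.

Local Open Scope classical_set_scope.
Local Open Scope ring_scope.

(** Why the theorem is true. Write n = d + 1, r = 1 / n^2 and eps = 4 L r. The
    map f below oscillates at the scale r, which is finer than eps, with
    amplitude at most eps; a 1-Lipschitz condition on an eps-separated set does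
    not see these oscillations. An L-Lipschitz map on the whole sphere cannot
    reproduce them, and misses a fixed proportion of them in each of d
    coordinates; the target is normed in such a way that these d losses add up.

    Domain. X is the sum of R and the l1 space of dimension d, with the maximum
    of the two norms ([cylinder]). Its unit sphere contains the flat face
    x_0 = 1, a copy of the l1 ball of dimension d. On the scale r this face
    looks like the whole l1 space, where d coordinates contribute additively
    to the distance; this is where the factor n comes from.

    Target and map. Let ramp_l be the function of one variable that equals r
    before l r, equals 0 after (l + 1) r, and is affine in between. The map f
    records all the numbers ramp_l (x_i), for i < d and l <= q + 1
    ([ramp_map]); q = d will do. The target Y consists of the arrays z(i, l)
    of reals, and its norm is the larger of
    - 4 L times the largest |z(i, l)|, and
    - the largest |sum_i (z(i, k_i + 1) - z(i, k_i))| over all choices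
      k_0, ..., k_(d-1) of indices ([jump_space]).
    Every ramp takes values in [0, r], so the first part never moves by more
    than 4 L r = eps. The difference ramp_(k+1) - ramp_k is a tent of height r
    with slopes 1 and -1, so the second part is 1-Lipschitz for the l1 norm.
    Hence f is 1-Lipschitz on any eps-separated set ([ramp_map_dist]).

    Lower bound. For k = (k_0, ..., k_(d-1)) let p_k be the point of the face
    with coordinates (k_i + 1) r, where the k_i-th tent in each coordinate i
    peaks: the k-th functional of the second part of the norm takes the value
    d r on f(p_k) ([total_jump_grid_point]). Suppose that F is L-Lipschitz and
    within t of f on the sphere; then the k-th functional is at least d r - t
    on F(p_k). Average this over all k. For one coordinate i, summing over k_i
    with the other indices fixed and summing by parts turns the sum of
    F(p_k)(i, k_i + 1) - F(p_k)(i, k_i) into boundary terms plus the changes of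
    a single entry of F along one step of the grid. By the first part of the
    norm such a change is at most L r / (4 L) = r / 4, and boundary terms are
    at most r + 2 t / (4 L). Therefore the average of the functionals is at
    most about d r / 4, unless t is already of the order of n r
    ([sum_total_jump_le], [almost_extension_bound]). In both cases t is at
    least of the order of n r, that is n eps / L. Passing from the net to the
    sphere changes the error by at most 4 L eps, which is small compared to
    n eps / L because n >= (5 L)^4 ([error_ge_of_bound]).

    This is stronger than what is claimed, because
    exp (2 sqrt (log n log (4 L))) >= (4 L)^2 as soon as 4 L <= n
    ([expR_sqrt_ln_ge]). *)

(** * Equivalent renormings of a Banach space *)

(* Matrices carry completeness and a norm separately: this joins the two. *)
HB.instance Definition _ (R : realType) m n := Complete.on 'M[R]_(m, n).

(** Both spaces of the theorem are matrix spaces with a norm that is not the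
    entrywise maximum. Asking for the comparison with the given norm makes
    completeness carry over without any appeal to finite dimension. *)
Record equiv_norm (R : realType) (V : completeNormedModType R) := EquivNorm {
  enorm :> V -> R;
  enormD : forall x y, enorm (x + y) <= enorm x + enorm y;
  enormZ : forall (a : R) x, enorm (a *: x) = `|a| * enorm x;
  enorm_ge : exists2 c, 0 < c & forall x, c * `|x| <= enorm x;
  enorm_le : exists2 C, 0 < C & forall x, enorm x <= C * `|x| }.

(** A synonym of V, so that the new norm does not compete with the old one. *)
Definition renormed (R : realType) (V : completeNormedModType R)
  (p : equiv_norm V) : Type := V.

Section Renormed.
Variables (R : realType) (V : completeNormedModType R) (p : equiv_norm V).

HB.instance Definition _ := GRing.Lmodule.copy (renormed p) V.

Lemma enorm0_eq0 (x : renormed p) : p x = 0 -> x = 0.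
Proof.
move=> px0; have [c c0 /(_ x)] := enorm_ge p.
by rewrite px0 pmulr_rle0// normr_le0 => /eqP.
Qed.

HB.instance Definition _ := Lmodule_isNormed.Build R (renormed p)
  (@enormD _ _ p) (@enormZ _ _ p) enorm0_eq0.

Lemma renormE (x : renormed p) : `|x| = p x.
Proof. by []. Qed.

Lemma renormed_complete (F : set_system (renormed p)) :
  ProperFilter F -> cauchy F -> cvg F.
Proof.
move=> FF /cauchy_ballP Fc.
have [c c0 pge] := enorm_ge p; have [C C0 ple] := enorm_le p.
have : cauchy (F : set_system V).
  apply/cauchy_ballP => e e0.
  have := Fc (c * e) (mulr_gt0 c0 e0).
  apply: filterS => -[x y]; rewrite -!ball_normE /= => xy.
  by rewrite -(ltr_pM2l c0) (le_lt_trans (pge _)).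
move=> /cauchy_cvg/cvg_ex[l Fl]; apply/cvg_ex; exists (l : renormed p).
apply/cvgrPdist_lt => e e0.
have /cvgrPdist_lt/(_ (e / C)) := Fl; rewrite divr_gt0// => /(_ isT).
apply: filterS => x /=; rewrite ltr_pdivlMr// mulrC => xl.
by rewrite renormE (le_lt_trans (ple _)).
Qed.

HB.instance Definition _ :=
  Uniform_isComplete.Build (renormed p) renormed_complete.

End Renormed.

Lemma renormed_has_dim (R : realType) n (p : equiv_norm 'rV[R]_n) :
  has_dim n (renormed p).
Proof. by constructor; exists idfun => //; exists idfun. Qed.

(** Both norms of the theorem arise in this way: a multiple of the entrywise
    maximum makes the norm definite, and the seminorm s carries the geometry. *)
Section MaxNorm.
Variables (R : realType) (V : completeNormedModType R) (c : R) (s : V -> R).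
Hypothesis c_gt0 : 0 < c.
Hypothesis sD : forall x y, s (x + y) <= s x + s y.
Hypothesis sZ : forall (a : R) x, s (a *: x) = `|a| * s x.
Hypothesis s_le : exists C, forall x, s x <= C * `|x|.

Let nrm x := Num.max (c * `|x|) (s x).

Lemma max_normD x y : nrm (x + y) <= nrm x + nrm y.
Proof.
rewrite ge_max (le_trans (ler_wpM2l (ltW c_gt0) (ler_normD x y))) ?mulrDr.
  by rewrite (le_trans (sD x y))// lerD// le_max lexx orbT.
by rewrite lerD// le_max lexx.
Qed.

Lemma max_normZ (a : R) x : nrm (a *: x) = `|a| * nrm x.
Proof. by rewrite /nrm normrZ sZ maxr_pMr// mulrCA. Qed.

Lemma max_norm_ge : exists2 c', 0 < c' & forall x, c' * `|x| <= nrm x.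
Proof. by exists c => // x; rewrite le_max lexx. Qed.

Lemma max_norm_le : exists2 C, 0 < C & forall x, nrm x <= C * `|x|.
Proof.
have [C sC] := s_le; exists (c + `|C|) => [|x]; first by rewrite ltr_wpDr.
rewrite ge_max ler_wpM2r ?lerDl//= (le_trans (sC x))// ler_wpM2r//.
by rewrite (le_trans (ler_norm C))// lerDr ltW.
Qed.

Definition max_norm : equiv_norm V :=
  EquivNorm max_normD max_normZ max_norm_ge max_norm_le.

End MaxNorm.

Lemma mx_entry_le (R : realType) m n (x : 'M[R]_(m, n)) i j : `|x i j| <= `|x|.
Proof.
rewrite [leRHS]/Num.norm /= mx_normrE.
exact: (le_bigmax _ (fun ij => `|x ij.1 ij.2|) (i, j)).
Qed.

Lemma mx_norm_le (R : realType) m n (x : 'M[R]_(m, n)) C :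
  0 <= C -> (forall i j, `|x i j| <= C) -> `|x| <= C.
Proof.
move=> C0 xC; rewrite [leLHS]/Num.norm /= mx_normrE.
by apply/bigmax_leP; split=> // -[i j] _; exact: xC.
Qed.

Lemma ler_sum_const (R : realType) d (f : 'I_d -> R) C :
  (forall i, f i <= C) -> \sum_i f i <= d%:R * C.
Proof.
move=> fC; apply: (le_trans (ler_sum _ (fun i _ => fC i))).
by rewrite sumr_const card_ord mulr_natl.
Qed.

(** * The domain: a cylinder over the l1 ball *)

(** The coordinate 0 is left out: it is the axis of the cylinder. *)
Definition tail_l1 (R : realType) d (x : 'rV[R]_d.+1) : R :=
  \sum_(i < d) `|x ord0 (lift ord0 i)|.

Section Cylinder.
Variables (R : realType) (d : nat).

Lemma tail_l1D (x y : 'rV[R]_d.+1) : tail_l1 (x + y) <= tail_l1 x + tail_l1 y.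
Proof.
by rewrite /tail_l1 -big_split ler_sum// => i _; rewrite mxE ler_normD.
Qed.

Lemma tail_l1Z a (x : 'rV[R]_d.+1) : tail_l1 (a *: x) = `|a| * tail_l1 x.
Proof.
by rewrite /tail_l1 mulr_sumr; apply: eq_bigr => i _; rewrite mxE normrM.
Qed.

Lemma tail_l1_le : exists C, forall x : 'rV[R]_d.+1, tail_l1 x <= C * `|x|.
Proof.
by exists d%:R => x; apply: ler_sum_const => i; exact: mx_entry_le.
Qed.

(** The l1 norm of the tail dominates each of its entries, so taking the maximum
    with all entries amounts to taking the maximum with |x_0|. *)
Definition cylinder : completeNormedModType R :=
  renormed (max_norm ltr01 tail_l1D tail_l1Z tail_l1_le).

Lemma cylinder_normE (x : 'rV[R]_d.+1) :
  `|x : cylinder| = Num.max `|x| (tail_l1 x).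
Proof. by rewrite -[in RHS](mul1r `|x|). Qed.

End Cylinder.

(** * The target: arrays measured by entries and by total jumps *)

Section JumpSpace.
Variables (R : realType) (d q : nat).
Implicit Types (z : 'M[R]_(d, q.+2)).

(** Columns run over 0, ..., q + 1, so that each of the q + 1 values of j has a
    column j + 1 as well as a column j. *)
Definition jump z i (j : 'I_q.+1) : R :=
  z i (lift ord0 j) - z i (widen_ord (leqnSn _) j).

Definition total_jump z (k : {ffun 'I_d -> 'I_q.+1}) : R :=
  \sum_i jump z i (k i).

Definition max_jump z : R := \big[Num.max/0]_k `|total_jump z k|.

Lemma total_jumpD z z' k :
  total_jump (z + z') k = total_jump z k + total_jump z' k.
Proof.
rewrite /total_jump -big_split; apply: eq_bigr => i _.
by rewrite /jump /= !mxE; ring.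
Qed.

Lemma total_jumpZ a z k : total_jump (a *: z) k = a * total_jump z k.
Proof.
rewrite /total_jump mulr_sumr; apply: eq_bigr => i _.
by rewrite /jump /= !mxE; ring.
Qed.

Lemma total_jumpB z z' k :
  total_jump (z - z') k = total_jump z k - total_jump z' k.
Proof. by rewrite total_jumpD -scaleN1r total_jumpZ mulN1r. Qed.

Lemma max_jump_ge z k : `|total_jump z k| <= max_jump z.
Proof. exact: (le_bigmax _ (fun k => `|total_jump z k|)). Qed.

Lemma max_jump_ge0 z : 0 <= max_jump z.
Proof. exact: bigmax_ge_id. Qed.

Lemma max_jumpD z z' : max_jump (z + z') <= max_jump z + max_jump z'.
Proof.
apply/bigmax_leP; split=> [|k _]; first by rewrite addr_ge0// max_jump_ge0.
by rewrite total_jumpD (le_trans (ler_normD _ _))// lerD// max_jump_ge.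
Qed.

Lemma max_jumpZ a z : max_jump (a *: z) = `|a| * max_jump z.
Proof.
rewrite /max_jump.
under eq_bigr do rewrite total_jumpZ normrM.
by elim/big_ind2 : _ => [|x1 x2 y1 y2 -> ->|//]; rewrite ?mulr0// maxr_pMr.
Qed.

Lemma max_jump_le : exists C, forall z, max_jump z <= C * `|z|.
Proof.
exists (d%:R * 2) => z; apply/bigmax_leP; split=> [|k _].
  by rewrite !mulr_ge0.
rewrite (le_trans (ler_norm_sum _ _ _))// -mulrA ler_sum_const// => i.
by rewrite (le_trans (ler_normB _ _))// mulr_natl mulr2n lerD// mx_entry_le.
Qed.

(** A large weight c controls the entries of a Lipschitz map, which change by at
    most s / c when its value moves by s; the price is that arrays with entries
    in [0, r] can be as far as c r apart. *)
Definition jump_space (c : R) (c0 : 0 < c) : completeNormedModType R :=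
  renormed (max_norm c0 max_jumpD max_jumpZ max_jump_le).

Lemma jump_space_normE c (c0 : 0 < c) z :
  `|z : jump_space c0| = Num.max (c * `|z|) (max_jump z).
Proof. by []. Qed.

End JumpSpace.

(** * Ramps and tents *)

Definition ramp (R : realType) (r : R) (l : nat) (t : R) : R :=
  Num.max 0 (Num.min r (l.+1%:R * r - t)).

Section Ramp.
Variables (R : realType) (r : R).
Hypothesis r_gt0 : 0 < r.

Lemma ramp_ge0 l t : 0 <= ramp r l t.
Proof. by rewrite le_max lexx. Qed.

Lemma ramp_le l t : ramp r l t <= r.
Proof. by rewrite ge_max ltW//= ge_min lexx. Qed.

(** The target sees jumps between consecutive ramps; they are tents, and hence
    vary no faster than one ramp. *)
Lemma ramp_diff l t :
  ramp r l.+1 t - ramp r l t = Num.max 0 (r - `|t - l.+1%:R * r|).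
Proof.
rewrite /ramp -[l.+2%:R]natr1 mulrDl mul1r; set a := l.+1%:R * r.
have [h|h] := leP 0 (t - a); rewrite ?(ger0_norm h) ?(ltr0_norm h);
  case: (leP r (a + r - t)) => h1; case: (leP r (a - t)) => h2;
  repeat (case: leP => ?); lra.
Qed.

Lemma ramp_diff_peak l : ramp r l.+1 (l.+1%:R * r) - ramp r l (l.+1%:R * r) = r.
Proof. by rewrite ramp_diff subrr normr0 subr0 max_r// ltW. Qed.

Lemma max0_lipschitz (a b : R) : `|Num.max 0 a - Num.max 0 b| <= `|a - b|.
Proof.
have := ler_norm (a - b); have := ler_norm (b - a); rewrite [`|b - a|]distrC.
have := normr_ge0 (a - b); set n := `|a - b| => n0 nba nab.
rewrite ler_norml; case: (leP 0 a) => a0; case: (leP 0 b) => b0;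
  by apply/andP; split; lra.
Qed.

Lemma ramp_diff_lipschitz l s t :
  `|(ramp r l.+1 s - ramp r l s) - (ramp r l.+1 t - ramp r l t)| <= `|s - t|.
Proof.
rewrite !ramp_diff (le_trans (max0_lipschitz _ _))//.
rewrite opprB addrC addrA subrK (le_trans (ler_dist_dist _ _))//.
by rewrite [leRHS]distrC le_eqVlt; apply/orP; left; apply/eqP; congr `|_|; ring.
Qed.

End Ramp.

(** * Averaging total jumps over a grid *)

Definition update_at d (J : finType) (k : {ffun 'I_d -> J}) (i : 'I_d) (j : J) :=
  [ffun i' => if i' == i then j else k i'].

(** Resampling coordinate i does not change the average: exchanging the resampled
    value with the original one is an involution on the pairs (k, j). *)
Lemma sum_update_at (R : realType) d (J : finType) (a : {ffun 'I_d -> J} -> R) i :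
  \sum_k \sum_j a (update_at k i j) = #|J|%:R * \sum_k a k.
Proof.
rewrite pair_bigA /=.
pose h (p : {ffun 'I_d -> J} * J) := (update_at p.1 i p.2, p.1 i).
have hK : involutive h.
  move=> [k j]; rewrite /h /=; congr pair; last by rewrite ffunE eqxx.
  by apply/ffunP => i'; rewrite !ffunE; case: eqVneq => // ->.
rewrite (reindex_inj (inv_inj hK)) /= mulr_sumr.
rewrite -(pair_bigA _ (fun k j => a (update_at (update_at k i j) i (k i)))) /=.
apply: eq_bigr => k _; rewrite -sum1_card natr_sum mulr_suml.
by apply: eq_bigr => j _; rewrite mul1r; congr a; have [] := hK (k, j).
Qed.

(** Summation by parts: pairing v j (j + 1) with v (j + 1) (j + 1) leaves only
    differences in the first argument and two boundary terms. *)
Lemma sum_diag_steps (R : realType) (v : nat -> nat -> R) q B eta :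
  v q q.+1 - v 0 0 <= B ->
  (forall j, (j < q)%N -> v j j.+1 - v j.+1 j.+1 <= eta) ->
  \sum_(j < q.+1) (v j j.+1 - v j j) <= B + q%:R * eta.
Proof.
move=> vB ve.
have -> : \sum_(j < q.+1) (v j j.+1 - v j j) =
    v q q.+1 - v 0 0 + \sum_(j < q) (v j j.+1 - v j.+1 j.+1).
  elim: q {vB ve} => [|q IH]; first by rewrite big_ord_recl !big_ord0.
  by rewrite big_ord_recr /= IH [in RHS]big_ord_recr /=; ring.
by rewrite lerD// ler_sum_const// => j; exact: ve.
Qed.

(** The k-th functional is evaluated at the k-th array only. In each coordinate,
    the contributions along a line of the grid telescope up to the variation
    of a single entry between neighbours, which eta controls; the boundary
    costs B - A once per line, hence is divided by q + 1 in the average. *)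
Lemma sum_total_jump_le (R : realType) d q
    (u : {ffun 'I_d -> 'I_q.+1} -> 'M[R]_(d, q.+2)) A B eta :
  (forall k i l, A <= u k i l <= B) ->
  (forall k i j l, (j < q)%N ->
    `|u (update_at k i (inord j)) i l - u (update_at k i (inord j.+1)) i l|
      <= eta) ->
  q.+1%:R * \sum_k total_jump (u k) k <=
  #|{ffun 'I_d -> 'I_q.+1}|%:R * (d%:R * (B - A + q%:R * eta)).
Proof.
move=> uAB ueta; rewrite /total_jump exchange_big /= mulr_sumr.
rewrite mulrCA; apply: ler_sum_const => i.
have -> : q.+1%:R = #|'I_q.+1|%:R :> R by rewrite card_ord.
rewrite -(sum_update_at _ i) -[#|{ffun _}|]sum1_card natr_sum mulr_suml.
apply: ler_sum => k _; rewrite mul1r.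
pose v (j l : nat) := u (update_at k i (inord j)) i (inord l).
have vlast : v q q.+1 - v 0 0 <= B - A.
  have /andP[_ +] := uAB (update_at k i (inord q)) i (inord q.+1).
  have /andP[+ _] := uAB (update_at k i (inord 0)) i (inord 0).
  by rewrite /v; lra.
have vstep j : (j < q)%N -> v j j.+1 - v j.+1 j.+1 <= eta.
  by move=> jq; apply: le_trans (ler_norm _) _; exact: ueta.
apply: le_trans (sum_diag_steps vlast vstep); apply: ler_sum => j _.
rewrite /jump /v ffunE eqxx inord_val le_eqVlt.
apply/orP; left; apply/eqP; congr (u _ _ _ - u _ _ _); apply/val_inj => /=.
- by rewrite inordK// ltnS.
- by rewrite inordK// ltnS ltnW.
Qed.

(** * The ramp map and its Lipschitz approximations *)

Definition ramp_map (R : realType) (r : R) d q (x : 'rV[R]_d.+1) :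
    'M[R]_(d, q.+2) :=
  \matrix_(i, l) ramp r l (x ord0 (lift ord0 i)).

Definition grid_point (R : realType) (r : R) d q (k : {ffun 'I_d -> 'I_q.+1}) :
    'rV[R]_d.+1 :=
  \row_s (if unlift ord0 s is Some i then (k i).+1%:R * r else 1).

Section RampMap.
Variables (R : realType) (r : R) (d q : nat).
Hypothesis r_gt0 : 0 < r.

Lemma jump_ramp_map (x : 'rV[R]_d.+1) i (j : 'I_q.+1) :
  jump (ramp_map r q x) i j =
  ramp r j.+1 (x ord0 (lift ord0 i)) - ramp r j (x ord0 (lift ord0 i)).
Proof. by rewrite /jump !mxE. Qed.

(** The weighted entries of the ramp map can be as steep as c, but they never
    move by more than c r, and its total jumps are sums of tents, hence
    1-Lipschitz. This makes the map 1-Lipschitz on every set separated by c r,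
    however the set is placed. *)
Lemma ramp_map_dist c (c0 : 0 < c) (x y : 'rV[R]_d.+1) :
  `|(ramp_map r q x : jump_space d q c0) - ramp_map r q y|
  <= Num.max (c * r) `|(x : cylinder R d) - y|.
Proof.
rewrite jump_space_normE ge_max; apply/andP; split; rewrite le_max.
  rewrite ler_pM2l//; apply/orP; left; apply: mx_norm_le => [|i l].
    exact: ltW.
  rewrite !mxE.
  have := ramp_ge0 r l (x ord0 (lift ord0 i)).
  have := ramp_le r_gt0 l (x ord0 (lift ord0 i)).
  have := ramp_ge0 r l (y ord0 (lift ord0 i)).
  have := ramp_le r_gt0 l (y ord0 (lift ord0 i)).
  by rewrite ler_norml; move=> *; apply/andP; split; lra.
apply/orP; right; apply/bigmax_leP; split=> // k _.
rewrite cylinder_normE le_max; apply/orP; right.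
rewrite total_jumpB /total_jump -sumrB (le_trans (ler_norm_sum _ _ _))//.
apply: ler_sum => i _; rewrite !jump_ramp_map !mxE.
exact: ramp_diff_lipschitz.
Qed.

Lemma grid_point_tail (k : {ffun 'I_d -> 'I_q.+1}) i :
  grid_point r k ord0 (lift ord0 i) = (k i).+1%:R * r.
Proof. by rewrite mxE liftK. Qed.

(** The hypothesis says that the whole grid fits in the l1 ball, so that the grid
    lies in the flat face x_0 = 1. *)
Lemma grid_point_sphere (k : {ffun 'I_d -> 'I_q.+1}) :
  d%:R * (q.+1%:R * r) <= 1 -> unit_sphere (cylinder R d) (grid_point r k).
Proof.
move=> dqr; rewrite /unit_sphere /= cylinder_normE.
have tail1 : tail_l1 (grid_point r k) <= 1.
  apply: le_trans dqr; apply: ler_sum_const => i; rewrite grid_point_tail.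
  by rewrite normrM normr_nat gtr0_norm// ler_pM2r// ler_nat.
have head1 : grid_point r k ord0 ord0 = 1 by rewrite mxE unlift_none.
apply/eqP; rewrite eq_le ge_max tail1 le_max andbT; apply/andP; split.
  apply: mx_norm_le => // i s; rewrite ord1.
  case: (unliftP ord0 s) => [t ->|->]; last by rewrite head1 normr1.
  apply: le_trans tail1; rewrite /tail_l1 (bigD1 t)//= lerDl.
  exact: sumr_ge0.
by rewrite -[leLHS]normr1 -head1 mx_entry_le.
Qed.

Lemma total_jump_grid_point (k : {ffun 'I_d -> 'I_q.+1}) :
  total_jump (ramp_map r q (grid_point r k)) k = d%:R * r.
Proof.
rewrite /total_jump; under eq_bigr do
  rewrite jump_ramp_map grid_point_tail ramp_diff_peak//.
by rewrite sumr_const card_ord mulr_natl.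
Qed.

Lemma grid_point_step (k : {ffun 'I_d -> 'I_q.+1}) i j : (j < q)%N ->
  `|(grid_point r (update_at k i (inord j)) : cylinder R d)
    - grid_point r (update_at k i (inord j.+1))| <= r.
Proof.
move=> jq; rewrite cylinder_normE.
have E t : (grid_point r (update_at k i (inord j)) -
    grid_point r (update_at k i (inord j.+1))) ord0 (lift ord0 t) =
    if t == i then - r else 0.
  rewrite !mxE liftK !ffunE; case: eqVneq => _.
    by rewrite !inordK ?ltnS// 1?ltnW// -[j.+2%:R]natr1; ring.
  by rewrite subrr.
rewrite ge_max; apply/andP; split.
  apply: mx_norm_le => [|a s]; first exact: ltW.
  rewrite ord1; case: (unliftP ord0 s) => [t ->|->].
    rewrite E; case: ifP => _; last by rewrite normr0 ltW.
    by rewrite normrN gtr0_norm.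
  by rewrite !mxE unlift_none subrr normr0 ltW.
rewrite /tail_l1 (bigD1 i)//= big1 => [|t /negPf ti]; rewrite E.
  by rewrite eqxx addr0 normrN gtr0_norm.
by rewrite ti normr0.
Qed.

(** The average over the grid of the functionals on F is at least d r - t, since
    they take the value d r on the ramp map; [sum_total_jump_le] bounds it from
    above, with entries of F at most t / c away from [0, r] and changing by at
    most L r / c along one step of the grid. For c = 4 L the right side, divided
    by q + 1, is close to d r / 4 when q is large compared to t / (L r). *)
Lemma almost_extension_bound c (c0 : 0 < c) (L t : R)
    (F : cylinder R d -> jump_space d q c0) :
  0 <= L -> d%:R * (q.+1%:R * r) <= 1 ->
  L.-lipschitz_(unit_sphere (cylinder R d)) F ->
  (forall x, unit_sphere (cylinder R d) x ->
    `|F x - (ramp_map r q x : jump_space d q c0)| <= t) ->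
  q.+1%:R * (d%:R * r - t) <= d%:R * (r + 2 * (t / c) + q%:R * (L * r / c)).
Proof.
move=> L0 dqr FL Ft.
pose p (k : {ffun 'I_d -> 'I_q.+1}) : cylinder R d := grid_point r k.
pose u k : 'M[R]_(d, q.+2) := F (p k).
have pS k : unit_sphere (cylinder R d) (p k) by exact: grid_point_sphere.
have entry (z : jump_space d q c0) i l :
    `|(z : 'M[R]_(d, q.+2)) i l| <= `|z| / c.
  rewrite ler_pdivlMr// mulrC jump_space_normE le_max ler_pM2l//.
  by rewrite mx_entry_le.
have jmp (z : jump_space d q c0) k :
    `|total_jump (z : 'M[R]_(d, q.+2)) k| <= `|z|.
  by rewrite jump_space_normE le_max max_jump_ge orbT.
have uAB k i l : - (t / c) <= u k i l <= r + t / c.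
  have : `|u k i l - ramp_map r q (p k) i l| <= t / c.
    have := entry (F (p k) - (ramp_map r q (p k) : jump_space d q c0)) i l.
    rewrite !mxE => /le_trans; apply.
    by rewrite ler_pM2r ?invr_gt0// Ft.
  rewrite [ramp_map _ _ _ _ _]mxE ler_distl => /andP[].
  have := ramp_ge0 r l (p k ord0 (lift ord0 i)).
  have := ramp_le r_gt0 l (p k ord0 (lift ord0 i)).
  by move=> *; apply/andP; split; lra.
have ustep k i j l : (j < q)%N ->
    `|u (update_at k i (inord j)) i l - u (update_at k i (inord j.+1)) i l|
      <= L * r / c.
  move=> jq.
  have := entry
    (F (p (update_at k i (inord j))) - F (p (update_at k i (inord j.+1)))) i l.
  rewrite !mxE => /le_trans; apply; rewrite ler_pM2r ?invr_gt0//.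
  have := FL (p (update_at k i (inord j)), p (update_at k i (inord j.+1))).
  move=> /(_ (conj (pS _) (pS _))) /= /le_trans; apply.
  by rewrite ler_wpM2l// grid_point_step.
have upper := sum_total_jump_le uAB ustep.
have lower : #|{ffun 'I_d -> 'I_q.+1}|%:R * (d%:R * r - t)
    <= \sum_k total_jump (u k) k.
  rewrite -sum1_card natr_sum mulr_suml; apply: ler_sum => k _; rewrite mul1r.
  have := jmp (F (p k) - (ramp_map r q (p k) : jump_space d q c0)) k.
  move=> /le_trans/(_ (Ft _ (pS k))).
  by rewrite total_jumpB total_jump_grid_point ler_distl => /andP[].
have card0 : 0 < #|{ffun 'I_d -> 'I_q.+1}|%:R :> R.
  by rewrite ltr0n; apply/card_gt0P; exists [ffun=> ord0].
rewrite -(ler_pM2l card0) mulrCA.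
apply: le_trans (ler_wpM2l _ lower) _; first exact: ler0n.
apply: le_trans upper _; rewrite le_eqVlt; apply/orP; left; apply/eqP.
by congr (_ * (_ * _)); ring.
Qed.

End RampMap.

(** * Nets of the sphere *)

Lemma finite_set_inj_fin (T : pointedType) (J : finType) (A : set T)
    (g : T -> J) :
  (forall a b, A a -> A b -> g a = g b -> a = b) -> finite_set A.
Proof.
move=> gI; pose h j := xget point (A `&` [set a | g a = j]).
apply: (@sub_finite_set _ _ (h @` setT)); last exact/finite_image/finite_finset.
move=> a Aa; exists (g a) => //.
have [Ah gh] : (A `&` [set b | g b = g a]) (h (g a)) by apply: xgetPex; exists a.
exact: gI.
Qed.

(** Pigeonhole on the cells of side D: a point is determined by its cell, and
    finitely many cells meet the unit ball. *)
Lemma separated_finite (R : realType) m n (N : set 'M[R]_(m, n)) (D : R) :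
  0 < D -> (forall a, N a -> `|a| <= 1) ->
  (forall a b, N a -> N b -> a <> b -> D < `|a - b|) -> finite_set N.
Proof.
move=> D0 Nb Nsep.
pose cell (t : R) := Num.truncn ((t + 1) / D).
pose K := Num.truncn (2 / D).
pose g (a : 'M[R]_(m, n)) : {ffun 'I_m * 'I_n -> 'I_K.+1} :=
  [ffun ij => inord (cell (a ij.1 ij.2))].
have arg_ge0 a i j : N a -> 0 <= (a i j + 1) / D.
  move=> /Nb; move/(le_trans (mx_entry_le a i j)).
  by rewrite ler_norml => /andP[? _]; apply: divr_ge0; [lra | exact: ltW].
have cellK a i j : N a -> (cell (a i j) < K.+1)%N.
  move=> /Nb; move/(le_trans (mx_entry_le a i j)).
  rewrite ltnS ler_norml => /andP[_ a1]; apply: le_truncn.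
  by rewrite ler_pM2r ?invr_gt0//; lra.
apply: (@finite_set_inj_fin _ _ _ g) => a b Na Nb' gab.
apply: contrapT => ab; have := Nsep _ _ Na Nb' ab; apply/negP; rewrite -leNgt.
apply: mx_norm_le => [|i j]; first exact: ltW.
have cab : cell (a i j) = cell (b i j).
  by move/ffunP/(_ (i, j))/(congr1 val): gab; rewrite !ffunE /= !inordK ?cellK.
have /andP[a1 a2] := truncn_itv (arg_ge0 _ i j Na).
have /andP[b1 b2] := truncn_itv (arg_ge0 _ i j Nb').
have := cab; rewrite /cell => E; rewrite E in a1 a2.
move: a1 a2 b1 b2; set k := Num.truncn _.
rewrite !ler_pdivlMr// !ltr_pdivrMr// -natr1 mulrDl mul1r !mxE => *.
by rewrite ler_norml; apply/andP; split; lra.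
Qed.

Lemma finite_maximum (R : realType) (T : choiceType) (N : set T) (g : T -> R) :
  finite_set N -> N !=set0 -> exists m, is_maximum [set g a | a in N] m.
Proof.
move=> /finite_seqP[s ->] [x0 /= x0s].
suff [y ys yM] : exists2 y, y \in s & forall x, x \in s -> g x <= g y.
  exists (g y); split; first by exists y.
  by move=> _ [x xs <-]; exact: yM.
have [i _ iM] :=
  @arg_maxP _ R (seq_sub s) (SeqSub x0s) xpredT (fun i => g (val i)) isT.
exists (val i); first exact: valP.
by move=> x xs; exact: (iM (SeqSub xs)).
Qed.

Lemma cylinder_norm_equiv (R : realType) d (x : 'rV[R]_d.+1) :
  `|x| <= `|x : cylinder R d| <= d.+1%:R * `|x|.
Proof.
rewrite cylinder_normE le_max lexx ge_max /= ler_peMl ?ler1n//=.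
rewrite (le_trans (ler_sum_const (fun i => mx_entry_le x ord0 (lift ord0 i))))//.
by rewrite ler_wpM2r// ler_nat.
Qed.

(** Finiteness is what makes the error of an approximation a maximum. *)
Lemma eps_net_finite (R : realType) d (N : set (cylinder R d)) (eps : R) :
  0 < eps -> eps_net eps (unit_sphere _) N -> finite_set N.
Proof.
move=> e0 [NS Nsep _].
have n0 : 0 < (d.+2%:R : R) by [].
apply: (@separated_finite R 1 d.+1 N (eps / d.+2%:R)).
- exact: divr_gt0.
- by move=> a /NS aS; have /andP[+ _] := cylinder_norm_equiv a; rewrite aS.
- move=> a b Na Nb ab; rewrite ltr_pdivrMr//.
  have eab := Nsep _ _ Na Nb ab.
  have /andP[_ Cab] := cylinder_norm_equiv (a - b).
  have ab0 : 0 < `|(a : 'rV_d.+1) - b|.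
    by rewrite normr_gt0 subr_eq0; apply/eqP.
  apply: (le_lt_trans eab); apply: (le_lt_trans Cab).
  by rewrite mulrC ltr_pM2l// ltr_nat.
Qed.

(** The infimum in the definition of a net need not be attained, hence the
    factor 2. *)
Lemma eps_net_near (R : realType) (X : normedModType R) (S N : set X) (eps : R) x :
  0 < eps -> eps_net eps S N -> S x -> exists2 a, N a & `|x - a| < 2 * eps.
Proof.
move=> e0 [_ _ Nd] /Nd xN.
have /ereal_inf_lt[_ [a Na <-]] :
    (ereal_inf [set `|x - a|%:E | a in N] < (2 * eps)%:E)%E.
  by rewrite (le_lt_trans xN)// lte_fin; lra.
by rewrite lte_fin => ?; exists a.
Qed.

(** * Numerical estimates and conclusion *)

(** Since log x <= log n, the exponent is at least 2 log x. *)
Lemma expR_sqrt_ln_ge (R : realType) (n x : R) :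
  1 <= x -> x <= n -> x ^+ 2 <= expR (2 * Num.sqrt (ln n * ln x)).
Proof.
move=> x1 xn; have x0 : 0 < x by exact: lt_le_trans x1.
have lx0 : 0 <= ln x by exact: ln_ge0.
have lxn : ln x <= ln n by rewrite ler_ln ?posrE// (lt_le_trans x0).
rewrite expRM_natl lerXn2r ?nnegrE ?expR_ge0 ?(ltW x0)//.
rewrite -[leLHS]lnK ?posrE// ler_expR.
rewrite -[leLHS](ger0_norm lx0) -sqrtr_sqr ler_sqrt.
  by rewrite expr2 ler_wpM2r.
by rewrite mulr_ge0// (le_trans lx0).
Qed.

Lemma powR_root4 (R : realType) (n : nat) (x : R) :
  0 <= x -> x <= n%:R `^ (4^-1) -> x ^+ 4 <= n%:R.
Proof.
move=> x0 xn; have : x ^+ 4 <= (n%:R `^ 4^-1) ^+ 4.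
  by rewrite lerXn2r// nnegrE powR_ge0.
by rewrite -(powR_mulrn 4 (powR_ge0 _ _)) -powRrM mulVf ?pnatr_eq0// powRr1.
Qed.

(** Here t is the error on the net and s the error on the whole sphere; q = d
    = n - 1 grid steps are enough. If t < n r / 4, then s < 0.28 n r because
    L^2 <= n / 625, and dividing the hypothesis by n^2 r leaves, up to lower
    order terms, 0.72 <= 0.39. *)
Lemma error_ge_of_bound (R : realType) (n L r t : R) :
  1 <= L -> 625 * L ^+ 4 <= n -> 0 < r ->
  let s := t + 16 * L ^+ 2 * r in
  n * ((n - 1) * r - s) <=
    (n - 1) * (r + 2 * (s / (4 * L)) + (n - 1) * (L * r / (4 * L))) ->
  n * r / 4 <= t.
Proof.
move=> L1 Ln r0 s bound; rewrite leNgt; apply/negP => tn.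
have L0 : 0 < L by lra.
have L21 : 1 <= L ^+ 2 by rewrite exprn_ege1.
have n625 : 625 * L ^+ 2 <= n.
  apply: le_trans Ln; rewrite (ler_wpM2l (ler0n R 625))//.
  rewrite (_ : L ^+ 4 = L ^+ 2 * L ^+ 2); first by rewrite ler_peMl// sqr_ge0.
  by ring.
have n1 : 625 <= n by lra.
have nr0 : 0 < n * r by rewrite mulr_gt0//; lra.
have sn : s <= 7 / 25 * (n * r).
  have : L ^+ 2 * r * 625 <= n * r by rewrite mulrAC ler_pM2r// mulrC.
  by rewrite /s => ?; lra.
have n0 : 0 < n - 1 by lra.
have quarter : L * r / (4 * L) = r / 4 by field; rewrite gt_eqF.
have sL : 2 * (s / (4 * L)) <= 7 / 50 * (n * r).
  have [s0|s0] := leP 0 s.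
    have : s / (4 * L) <= s / 4.
      by rewrite ler_wpM2l// lef_pV2 ?posrE; lra.
    lra.
  have : s / (4 * L) <= 0 by rewrite pmulr_lle0 ?invr_gt0; lra.
  lra.
rewrite quarter in bound.
have up : (n - 1) * (r + 2 * (s / (4 * L)) + (n - 1) * (r / 4)) <=
    (n - 1) * (r + 7 / 50 * (n * r) + (n - 1) * (r / 4)).
  by rewrite ler_pM2l// lerD2r lerD2l.
have lo : n * ((n - 1) * r - 7 / 25 * (n * r)) <= n * ((n - 1) * r - s).
  by rewrite ler_pM2l ?lerD2l ?lerN2//; lra.
have := le_trans lo (le_trans bound up); apply/negP; rewrite -ltNge -subr_gt0.
rewrite (_ : _ - _ = r * (33 / 100 * n ^+ 2 - 34 / 25 * n + 3 / 4)); last by field.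
by rewrite mulr_gt0//; nra.
Qed.

Theorem theorem2 (R : realType) :
  exists c : R, 0 < c /\
  forall (n : nat) (L : R), 1 <= L -> 5 * L <= n%:R `^ (4^-1) ->
  exists (X Y : completeNormedModType R) (eps : R),
    [/\ has_dim n X, 0 < eps &
    forall N : set X, eps_net eps (unit_sphere X) N ->
    exists f : X -> Y, (1 : R).-lipschitz_N f /\
    forall F : X -> Y, L.-lipschitz_(unit_sphere X) F ->
    exists2 m : R, is_maximum [set `|F a - f a| | a in N] m &
      c * (L * n%:R / expR (2 * Num.sqrt (ln n%:R * ln (4 * L)))) * eps <= m].
Proof.
exists 1; split=> // n L L1 Ln.
have {Ln} : (5 * L) ^+ 4 <= n%:R by apply: powR_root4 => //; lra.
have L0 : 0 < L by lra.
rewrite exprMn (_ : 5 ^+ 4 = 625); last by ring.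
case: n => [|d] Ln.
  by move: Ln; rewrite leNgt (mulr_gt0 (ltr0Sn R 624) (exprn_gt0 4 L0)).
set n : R := d.+1%:R in Ln *.
have n0 : 0 < n by exact: ltr0Sn.
have dn : d%:R = n - 1 :> R by rewrite /n -natr1 addrK.
(* The largest scale, up to constants, at which d coordinates with d + 1 steps
   each still fit in the l1 ball. *)
pose r : R := (n ^+ 2)^-1.
have r0 : 0 < r by rewrite invr_gt0 exprn_gt0.
have c0 : 0 < 4 * L by lra.
have dqr : d%:R * (d.+1%:R * r) <= 1 :> R.
  rewrite -/n [leRHS](_ : 1 = n * (n * r)).
    by rewrite dn ler_pM2r ?mulr_gt0//; lra.
  by rewrite /r; field; rewrite gt_eqF.
pose eps := 4 * L * r.
have e0 : 0 < eps by exact: mulr_gt0.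
exists (cylinder R d), (jump_space d d c0), eps; split=> //.
  exact: renormed_has_dim.
move=> N Nnet; have [NS Nsep _] := Nnet.
exists (ramp_map r d); split.
  move=> -[a b] [/= Na Nb]; rewrite mul1r /=.
  have [->|/eqP ab] := eqVneq a b; first by rewrite !subrr !normr0.
  apply: le_trans (ramp_map_dist d r0 c0 a b) _.
  by rewrite ge_max lexx (Nsep _ _ Na Nb ab).
move=> F FL.
pose x0 : cylinder R d := grid_point r [ffun=> ord0 : 'I_d.+1].
have x0S : unit_sphere _ x0 by exact: grid_point_sphere.
have [a0 Na0 _] := eps_net_near e0 Nnet x0S.
have [m mmax] := @finite_maximum R _ N (fun a => `|F a - ramp_map r d a|)
  (eps_net_finite e0 Nnet) (ex_intro _ a0 Na0).
exists m => //.
(* From the net to the sphere: moving to a net point at distance at most 2 eps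
   costs 2 L eps for F and 2 eps for the ramp map, together at most 4 L eps. *)
have Fm x : unit_sphere (cylinder R d) x ->
    `|F x - (ramp_map r d x : jump_space d d c0)| <= m + 16 * L ^+ 2 * r.
  move=> Sx; have [a Na xa] := eps_net_near e0 Nnet Sx.
  have Fa : `|F a - (ramp_map r d a : jump_space d d c0)| <= m.
    by case: mmax => _; apply; exists a.
  have Fxa : `|F x - F a| <= L * (2 * eps).
    apply: le_trans (FL (x, a) (conj Sx (NS _ Na))) _ => /=.
    by rewrite ler_pM2l// ltW.
  have fax : `|(ramp_map r d x : jump_space d d c0) - ramp_map r d a| <= 2 * eps.
    apply: le_trans (ramp_map_dist d r0 c0 x a) _.
    by rewrite ge_max (ltW xa) andbT -/eps; lra.
  rewrite (_ : F x - _ = (F x - F a) + (F a - (ramp_map r d a : jump_space d d c0))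
     - ((ramp_map r d x : jump_space d d c0) - ramp_map r d a)); last first.
    by rewrite opprB !addrA !subrK.
  apply: le_trans (ler_normB _ _) _.
  apply: le_trans (lerD (ler_normD _ _) (lexx _)) _.
  apply: le_trans (lerD (lerD Fxa Fa) fax) _.
  have : L * r <= L * r * L by rewrite ler_peMr// ltW ?mulr_gt0.
  by rewrite /eps => ?; lra.
have := almost_extension_bound r0 (ltW L0) dqr FL Fm.
rewrite dn -/n => /(error_ge_of_bound L1 Ln r0); apply: le_trans.
have n4L : 4 * L <= n.
  apply: le_trans Ln; have : L <= L ^+ 4 by rewrite ler_eXnr.
  by lra.
have E := expR_sqrt_ln_ge (_ : 1 <= 4 * L) n4L.
set X := expR _ in E *.
have X0 : 0 < X by exact: expR_gt0.
rewrite mul1r mulrAC ler_pdivrMr//.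
have -> : L * n * eps = n * r / 4 * (4 * L) ^+ 2 by rewrite /eps; field.
by rewrite ler_pM2l ?divr_gt0 ?mulr_gt0// E//; lra.
Qed.
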